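(* For any hyperbolic polynomial $p$ of degree $n\geq1$, any $\theta\in[0,\pi)$, and any $h>0$, the following inequalities hold: $$\mu_{max}(\Delta_{\theta,h}(p))\leq\mu_{max}(p)+h\cdot\mu_{max}(Q_n)\quad\text{and}\quad\mu_{min}(\Delta_{\theta,h}(p))\geq\mu_{min}(p)+h\cdot\mu_{min}(Q_n).$$
   Context: A hyperbolic polynomial is a real polynomial with only real roots. For a hyperbolic polynomial $q$, $\mu_{max}(q)$ and $\mu_{min}(q)$ denote its maximal and minimal roots, respectively. The operator is $$\Delta_{\theta,h}(p)(x)=\frac{e^{i\theta}p(x+ih)-e^{-i\theta}p(x-ih)}{2i}.$$ The polynomial $Q_n$ (depending on $\theta$) is $Q_n(x)=\Delta_{\theta,1}(x^n)=\frac{e^{i\theta}(x+i)^n-e^{-i\theta}(x-i)^n}{2i}$. *)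

(* Defs.v *)
From HB Require Import structures.
From mathcomp Require Import all_boot all_order all_algebra.
From mathcomp Require Import ring lra.
From mathcomp Require Import polyrcf complex.
From mathcomp Require Import all_classical all_reals all_analysis.

Set Implicit Arguments.
Unset Strict Implicit.
Unset Printing Implicit Defensive.

Import Order.TTheory GRing.Theory Num.Theory.

Local Open Scope complex_scope.
Local Open Scope classical_set_scope.
Local Open Scope ring_scope.

Definition polyC_of (R : realType) (p : {poly R}) : {poly R[i]} :=
  map_poly (real_complex R) p.

(* Every nonzero constant is hyperbolic; the zero polynomial is not. *)
Definition hyperbolic (R : realType) (p : {poly R}) : Prop :=
  forall z : R[i], root (polyC_of p) z -> complex.Im z = 0.

(* Values in \bar R: for a hyperbolic polynomial of positive degree these are
   the largest and smallest roots (mu_maxP, mu_minP below), while for a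
   nonzero constant mu_max is -oo and mu_min is +oo. *)
Definition mu_max (R : realType) (q : {poly R}) : \bar R :=
  ereal_sup [set x%:E | x in [set x | root q x]].
Definition mu_min (R : realType) (q : {poly R}) : \bar R :=
  ereal_inf [set x%:E | x in [set x | root q x]].

Definition expi (R : realType) (theta : R) : R[i] :=
  (cos theta +i* sin theta)%C.

Definition DeltaC (R : realType) (theta h : R) (p : {poly R}) : {poly R[i]} :=
  (2 * 'i%C)^-1 *:
    (expi theta *: (polyC_of p \Po ('X + (h%:C * 'i%C)%:P))
     - expi (- theta) *: (polyC_of p \Po ('X - (h%:C * 'i%C)%:P))).

(* DeltaC theta h p has real coefficients, so taking real parts
   coefficientwise loses nothing (DeltaE below). *)
Definition Delta (R : realType) (theta h : R) (p : {poly R}) : {poly R} :=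
  map_poly (@complex.Re R) (DeltaC theta h p).

Definition Q (R : realType) (theta : R) (n : nat) : {poly R} :=
  Delta theta 1 'X^n.

Lemma conj_expi (R : realType) (theta : R) :
  conjc (expi theta) = expi (- theta).
Proof. by rewrite /expi /= cosN sinN. Qed.

Lemma conj_i (R : realType) : conjc ('i%C : R[i]) = - 'i%C.
Proof. by rewrite /=; apply/eqP; rewrite eq_complex /= oppr0 !eqxx. Qed.

Lemma map_DeltaC (R : realType) (f : {rmorphism R[i] -> R[i]})
    (theta h : R) (p : {poly R}) :
    (forall x : R, f x%:C = x%:C) -> (forall x, f (expi x) = expi (- x)) ->
    f 'i%C = - 'i%C ->
  map_poly f (DeltaC theta h p) = DeltaC theta h p.
Proof.
move=> fR fE fi.
have fP : map_poly f (polyC_of p) = polyC_of p.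
  by apply/polyP => k; rewrite !coef_map; exact: fR.
rewrite /DeltaC; move: 'i%C h%:C fi (fR h) => I H fI fH.
have := fE (- theta); rewrite opprK.
move: (expi theta) (expi (- theta)) (fE theta) => E F fEF fFE.
rewrite map_polyZ rmorphB /= !map_polyZ !map_comp_poly rmorphD rmorphB /=.
rewrite !map_polyX !map_polyC /= fP fEF fFE fmorphV /= !rmorphM rmorph_nat /=.
by rewrite fI fH !polyCN !mulrN opprK invrN scaleNr -scalerN opprB.
Qed.

Lemma conj_DeltaC (R : realType) (theta h : R) (p : {poly R}) :
  map_poly conjc (DeltaC theta h p) = DeltaC theta h p.
Proof.
apply: map_DeltaC => [x|x|]; last exact: conj_i.
  by rewrite /= oppr0.
exact: conj_expi.
Qed.

Lemma DeltaE (R : realType) (theta h : R) (p : {poly R}) :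
  polyC_of (Delta theta h p) = DeltaC theta h p.
Proof.
apply/polyP => k; rewrite coef_map /Delta [in LHS]coef_map_id0 //=.
have := conj_DeltaC theta h p => /(congr1 (fun q : {poly _} => q`_k)).
rewrite coef_map; case: (_`_k) => a b /= [] /eqP.
by rewrite eq_sym -addr_eq0 -mulr2n mulrn_eq0 /= => /eqP ->.
Qed.

Lemma horner_Delta (R : realType) (theta h x : R) (p : {poly R}) :
  (Delta theta h p).[x]%:C =
  (expi theta * (polyC_of p).[x%:C + h%:C * 'i%C]
   - expi (- theta) * (polyC_of p).[x%:C - h%:C * 'i%C]) / (2 * 'i%C).
Proof.
rewrite -horner_map /= -[map_poly _ _]/(polyC_of _) DeltaE.
by rewrite /DeltaC !hornerE !horner_comp !hornerE mulrC.
Qed.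

Lemma hyperbolic_root (R : realType) (q : {poly R}) :
  hyperbolic q -> (1 < size q)%N -> exists x, root q x.
Proof.
move=> hq sq.
have /closed_rootP[z rz] : size (polyC_of q) != 1%N.
  by rewrite size_map_poly; case: (size q) sq => [|[]].
exists (complex.Re z); rewrite -(fmorph_root (real_complex R)) /=.
have := hq _ rz; case: z rz => a b /= rz b0.
by rewrite b0 in rz.
Qed.

Lemma seq_max (R : realType) (s : seq R) : s != [::] ->
  exists2 x, x \in s & forall y, y \in s -> y <= x.
Proof.
elim: s => // a [_ _|b s /(_ isT)[x xs xmax] _].
  by exists a; rewrite ?inE// => y; rewrite inE => /eqP ->.
have [ax|xa] := leP a x.
  exists x; first by rewrite inE xs orbT.
  by move=> y; rewrite inE => /orP[/eqP ->//|/xmax].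
exists a; first by rewrite inE eqxx.
by move=> y; rewrite inE => /orP[/eqP ->//|/xmax/le_trans]; apply; exact: ltW.
Qed.

Lemma root_seq (R : realType) (q : {poly R}) : (1 < size q)%N ->
  exists s : seq R, forall x, root q x = (x \in s).
Proof.
move=> sq; have q0 : q != 0 by rewrite -size_poly_gt0 ltnW.
exists (polyrcf.rootsR q) => x.
by have := polyrcf.roots_on_rootsR q0 x; rewrite in_itv.
Qed.

Lemma mu_maxP (R : realType) (q : {poly R}) :
    hyperbolic q -> (1 < size q)%N ->
  exists x, [/\ mu_max q = x%:E, root q x & forall y, root q y -> y <= x].
Proof.
move=> hq sq; have [s sE] := root_seq sq.
have [|x xs xmax] := @seq_max _ s.
  by have [x] := hyperbolic_root hq sq; rewrite sE; case: (s).
exists x; split; [|by rewrite sE|by move=> y; rewrite sE => /xmax].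
apply/eqP; rewrite eq_le; apply/andP; split.
  by apply: ge_ereal_sup => _ [y /= + <-]; rewrite sE lee_fin => /xmax.
by apply: ereal_sup_ubound; exists x => //=; rewrite sE.
Qed.

Lemma mu_minP (R : realType) (q : {poly R}) :
    hyperbolic q -> (1 < size q)%N ->
  exists x, [/\ mu_min q = x%:E, root q x & forall y, root q y -> x <= y].
Proof.
move=> hq sq; have [s sE] := root_seq sq.
have [|x] := @seq_max _ [seq - y | y <- s].
  by have [x] := hyperbolic_root hq sq; rewrite sE; case: (s).
case/mapP => {}x xs -> xmax.
have xmin y : root q y -> x <= y.
  by rewrite sE -lerN2 => ys; apply: xmax; apply: map_f.
exists x; split; [|by rewrite sE|exact: xmin].
apply/eqP; rewrite eq_le; apply/andP; split.
  by apply: ereal_inf_lbound; exists x => //=; rewrite sE.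
by apply: le_ereal_inf_tmp => _ [y /= + <-]; rewrite lee_fin => /xmin.
Qed.

Lemma normr_expi (R : realType) (theta : R) : `|expi theta| = 1.
Proof. by rewrite normc_def /= cos2Dsin2 sqrtr1. Qed.

Lemma hyperbolic_norm_lt (R : realType) (p : {poly R}) (w1 w2 : R[i]) :
    (1 < size p)%N -> hyperbolic p -> complex.Re w1 = complex.Re w2 ->
    complex.Im w1 ^+ 2 < complex.Im w2 ^+ 2 ->
  `|(polyC_of p).[w1]| < `|(polyC_of p).[w2]|.
Proof.
move=> sp hp Rew Imw.
have [r pE] := closed_field_poly_normal (polyC_of p).
have lc0 : lead_coef (polyC_of p) != 0.
  by rewrite lead_coef_eq0 -size_poly_gt0 size_map_poly ltnW.
have rI z : z \in r -> complex.Im z = 0.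
  by move=> zr; apply: hp; rewrite pE rootZ // root_prod_XsubC.
have r0 : r != [::].
  apply: contraTneq sp => r0; rewrite -(size_map_poly (real_complex R)).
  by rewrite -/(polyC_of p) pE r0 big_nil size_scale // size_poly1.
rewrite pE !hornerZ !horner_prod !normrM !normr_prod ltr_pM2l ?normr_gt0 //.
rewrite big_seq [ltRHS]big_seq; apply: ltr_prod.
  by case: (r) r0 => // z s _ /=; rewrite inE eqxx.
move=> z zr; rewrite normr_ge0 !hornerE !normc_def ltcR.
have := rI z zr; case: (z) (w1) (w2) Rew Imw => [a b] [x1 y1] [x2 y2] /=.
move=> -> Imw ->; rewrite !subr0 ltr_sqrt ?ltrD2l //.
by rewrite ltr_wpDl ?sqr_ge0 //; apply: le_lt_trans Imw; exact: sqr_ge0.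
Qed.

Lemma Delta_hyperbolic (R : realType) (theta h : R) (p : {poly R}) :
  0 < h -> (1 < size p)%N -> hyperbolic p -> hyperbolic (Delta theta h p).
Proof.
move=> h0 sp hp z.
rewrite DeltaE /root /DeltaC !hornerE !horner_comp !hornerE.
have i0 : 'i%C != 0 :> R[i] by rewrite eq_complex /= oner_eq0 andbF.
rewrite mulf_eq0 invr_eq0 mulf_eq0 pnatr_eq0 (negPf i0) /= subr_eq0.
move=> /eqP/(congr1 Num.norm); rewrite !normrM !normr_expi !mul1r => eqn.
have hi : h%:C * 'i%C = (0 +i* h)%C.
  by apply/eqP; rewrite eq_complex /= !mul0r !mulr0 mulr1 subr0 addr0 !eqxx.
rewrite hi in eqn; have [->//|nz] := eqVneq (complex.Im z) 0.
have Imz : (complex.Im z + h) ^+ 2 - (complex.Im z - h) ^+ 2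
    = 4 * h * complex.Im z by ring.
suff : False by [].
have ReE : complex.Re (z + (0 +i* h)%C) = complex.Re (z - (0 +i* h)%C).
  by case: (z) => a b /=; rewrite oppr0.
have ImE : (complex.Im (z + (0 +i* h)%C) = complex.Im z + h) /\
    (complex.Im (z - (0 +i* h)%C) = complex.Im z - h) by case: (z).
have lt2 := hyperbolic_norm_lt sp hp.
case: (ltgtP (complex.Im z) 0) nz => // sz _.
  suff /(lt2 _ _ ReE) : complex.Im (z + (0 +i* h)%C) ^+ 2
      < complex.Im (z - (0 +i* h)%C) ^+ 2 by rewrite eqn ltxx.
  by rewrite ImE.1 ImE.2 -subr_lt0 Imz; nra.
suff /(lt2 _ _ (esym ReE)) : complex.Im (z - (0 +i* h)%C) ^+ 2
    < complex.Im (z + (0 +i* h)%C) ^+ 2 by rewrite eqn ltxx.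
by rewrite ImE.1 ImE.2 -subr_gt0 Imz; nra.
Qed.

Lemma hyperbolic_Xn (R : realType) (n : nat) : hyperbolic ('X^n : {poly R}).
Proof.
move=> z; rewrite /polyC_of map_polyXn /root hornerXn expf_eq0.
by move=> /andP[_ /eqP ->].
Qed.

Lemma Q_hyperbolic (R : realType) (theta : R) (n : nat) :
  (1 <= n)%N -> hyperbolic (Q theta n).
Proof.
move=> n1; apply: Delta_hyperbolic => //; last exact: hyperbolic_Xn.
by rewrite size_polyXn ltnS.
Qed.

(* Main.v *)
(* For real y, Delta_{theta,h}(p)(y) = Im (e^{i theta} p(y + ih)), and p(y + ih)
   is up to a constant the product of the y - a + ih over the roots a of p.
   If every argument arg(y - a + ih) is less than phi = (pi - theta)/n, the
   product multiplied by e^{i theta} has argument in ]0, pi[ and y is no root.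
   This is the case when y > a + h cot(phi) for all a, and cot(phi) is a root
   of Q_n (unless phi = pi, when there is nothing to require of y).
   The minimal roots follow from the reflection x -> -x, which turns theta into
   pi - theta (theta = 0 being kept fixed). *)
Require Import Defs.
From mathcomp Require Import all_boot all_order all_algebra.
From mathcomp Require Import ring lra.
From mathcomp Require Import complex.
From mathcomp Require Import all_classical all_reals all_analysis.

Set Implicit Arguments.
Unset Strict Implicit.

Import Order.TTheory GRing.Theory Num.Theory.

Local Open Scope ring_scope.

(** * The unit circle and polar form in the open upper half-plane *)

Lemma expiD (R : realType) (a b : R) : expi (a + b) = expi a * expi b.
Proof.
apply/eqP; rewrite eq_complex /= cosD sinD eqxx /=.
by rewrite addrC eqxx.
Qed.

Lemma expi0 (R : realType) : expi (0 : R) = 1.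
Proof. by apply/eqP; rewrite eq_complex /= cos0 sin0 !eqxx. Qed.

Lemma expi_sum (R : realType) (I : Type) (s : seq I) (f : I -> R) :
  expi (\sum_(i <- s) f i) = \prod_(i <- s) expi (f i).
Proof. exact: (big_morph _ (@expiD R) (@expi0 R)). Qed.

Lemma complex_realM (R : realType) (r a b : R) :
  r%:C%C * (a +i* b)%C = ((r * a)%R +i* (r * b)%R)%C.
Proof. by apply/eqP; rewrite eq_complex /= !mul0r subr0 addr0 !eqxx. Qed.

Lemma polar_upper (R : realType) (a h : R) : 0 < h ->
  exists r phi, [/\ 0 < r, 0 < phi < pi & (a +i* h)%C = r%:C%C * expi phi].
Proof.
move=> h0; pose r := Num.sqrt (a ^+ 2 + h ^+ 2).
have s0 : 0 < a ^+ 2 + h ^+ 2 by rewrite ltr_wpDl ?sqr_ge0 ?exprn_gt0.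
have r0 : 0 < r by rewrite sqrtr_gt0.
have r2 : r ^+ 2 = a ^+ 2 + h ^+ 2 by rewrite sqr_sqrtr // ltW.
(* Strict because [h] is positive; this keeps the angle [acos (a / r)] away from 0 and [pi]. *)
have ar : -1 < a / r < 1 by rewrite ltr_pdivlMr // ltr_pdivrMr //; nra.
have arW : -1 <= a / r <= 1 by case/andP: ar => /ltW -> /ltW ->.
have sinE : sin (acos (a / r)) = h / r.
  rewrite sin_acos //; have -> : 1 - (a / r) ^+ 2 = (h / r) ^+ 2.
    have h2 : h ^+ 2 = r ^+ 2 - a ^+ 2 by rewrite r2 addrAC subrr add0r.
    by rewrite !expr_div_n h2; field; rewrite gt_eqF.
  by rewrite sqrtr_sqr ger0_norm // divr_ge0 // ltW.
exists r, (acos (a / r)); split => //.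
  rewrite acos_gt0 ?acos_ltpi //.
  - by case/andP: ar => -> /ltW ->.
  - by case/andP: ar => /ltW -> ->.
rewrite /expi sinE acosK ?in_itv //= complex_realM.
by congr (_ +i* _)%C; rewrite mulrC divfK // gt_eqF.
Qed.

(** * Real factorization and the argument of a product *)

Lemma hyperbolic_neq0 (R : realType) (p : {poly R}) : hyperbolic p -> p != 0.
Proof.
apply: contraPneq => -> /(_ 'i%C); rewrite /polyC_of rmorph0 root0 /=.
by move=> /(_ isT)/eqP; rewrite oner_eq0.
Qed.

(** The factorization over [R[i]] has only real roots, so it is the image of one over [R], and the
    embedding of polynomials is injective. *)
Lemma hyperbolic_split (R : realType) (p : {poly R}) : hyperbolic p ->
  exists s : seq R, p = lead_coef p *: \prod_(a <- s) ('X - a%:P).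
Proof.
move=> hp; have [z pE] := closed_field_poly_normal (polyC_of p).
have zI c : c \in z -> (complex.Re c)%:C%C = c.
  move=> cz; have : complex.Im c = 0.
    have lc0 : lead_coef (polyC_of p) != 0.
      by rewrite lead_coef_eq0 map_poly_eq0 hyperbolic_neq0.
    by apply: hp; rewrite pE rootZ // root_prod_XsubC.
  by case: c cz => a b _ /= ->.
exists [seq complex.Re c | c <- z].
apply: (map_poly_inj (real_complex R)).
rewrite -[LHS]/(polyC_of p) {1}pE map_polyZ lead_coef_map; congr (_ *: _).
rewrite rmorph_prod big_map big_seq [RHS]big_seq; apply: eq_bigr => c cz.
by rewrite rmorphB /= map_polyX map_polyC /= zI.
Qed.

(* Each factor has argument in ]0, phi[, so the product has its argument,
   shifted by theta, in ]0, pi[. *)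
Lemma Im_expi_prod_gt0 (R : realType) (theta phi h : R) (s : seq R) :
    0 < h -> 0 <= theta -> s != [::] -> 0 < phi <= pi ->
    theta + phi *+ size s = pi ->
    (forall a, a \in s -> h * cos phi < a * sin phi) ->
  0 < complex.Im (expi theta * \prod_(a <- s) (a +i* h)%C).
Proof.
move=> h0 theta0 s0 /andP[phi0 phipi] tE hs.
have /choice[g gP] a : exists x : R * R,
    [/\ 0 < x.1, 0 < x.2 < pi & (a +i* h)%C = x.1%:C%C * expi x.2].
  by have [r [f H]] := polar_upper a h0; exists (r, f).
have -> : \prod_(a <- s) (a +i* h)%C
    = (\prod_(a <- s) (g a).1)%:C%C * expi (\sum_(a <- s) (g a).2).
  rewrite expi_sum (rmorph_prod (real_complex R)) -big_split /=.
  by apply: eq_bigr => a _; case: (gP a).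
rewrite mulrCA -expiD complex_realM /= pmulr_rgt0; last first.
  by apply: prodr_gt0 => a _; case: (gP a).
have gphi a : a \in s -> 0 < (g a).2 < phi.
  move=> /hs; case: (gP a); move: (g a) => [r f] /= r0 /andP[f0 fpi].
  rewrite complex_realM f0 => -[-> ->]; rewrite -!mulrA ltr_pM2l //.
  (* With [a + ih = r e^(i f)] and [r] cancelled, the hypothesis on [a] reads [sin (f - phi) < 0],
     which fails when [phi <= f < pi]. *)
  apply: contraTT; rewrite -!leNgt => phif.
  have : 0 <= sin (f - phi) by apply: sin_ge0_pi; lra.
  by rewrite sinB; lra.
have hs0 : has [in s] s by case: (s) s0 => // a t _; rewrite /= inE eqxx.
have sum0 : 0 < \sum_(a <- s) (g a).2.
  rewrite big_seq; apply: (@le_lt_trans _ _ (\sum_(a <- s | a \in s) 0)).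
    by rewrite big1.
  by apply: ltr_sum => // a /gphi/andP[].
apply: sin_gt0_pi; rewrite ltr_wpDl //= -tE ltrD2l.
rewrite -sum1_size -sumrMnr big_seq [ltRHS]big_seq.
by apply: ltr_sum => // a /gphi/andP[].
Qed.

(** * Roots of [Delta] and their reflection *)

Lemma horner_conj (R : realType) (p : {poly R}) (z : R[i]%C) :
  (polyC_of p).[(z^*)%C] = (((polyC_of p).[z])^*)%C.
Proof.
rewrite -horner_map -map_poly_comp /=; congr (_.[_]).
by apply: eq_map_poly => x /=; rewrite oppr0.
Qed.

(** As [p] is real, the two terms of [Delta] at a real point are conjugate, so their difference is
    [2i] times an imaginary part. *)
Lemma root_Delta (R : realType) (theta h : R) (p : {poly R}) (y : R) :
  root (Delta theta h p) y =
  (complex.Im (expi theta * (polyC_of p).[(y +i* h)%C]) == 0).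
Proof.
have i0 : 'i%C != 0 :> R[i]%C by rewrite eq_complex /= oner_eq0 andbF.
rewrite rootE -(fmorph_eq0 (real_complex R)) /= horner_Delta.
have -> : y%:C%C + h%:C%C * 'i%C = (y +i* h)%C.
  by apply/eqP; rewrite eq_complex /= !mul0r mulr0 mulr1 subr0 !addr0
    add0r !eqxx.
have -> : y%:C%C - h%:C%C * 'i%C = ((y +i* h)^*)%C.
  by apply/eqP; rewrite eq_complex /= !mul0r mulr0 mulr1 !subr0 !addr0
    add0r !eqxx.
rewrite horner_conj -conj_expi -rmorphM /= subcJ.
rewrite -[(2%:R : R[i]%C) * _ * _]mulrAC mulrC mulKf ?mulf_neq0 ?pnatr_eq0 //.
by rewrite fmorph_eq0.
Qed.

Lemma root_Delta_scale (R : realType) (theta h c : R) (p : {poly R}) (y : R) :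
  c != 0 -> root (Delta theta h (c *: p)) y = root (Delta theta h p) y.
Proof.
move=> c0; rewrite !root_Delta /polyC_of map_polyZ hornerZ mulrCA /=.
by case: (expi _ * _) => a b; rewrite complex_realM mulf_eq0 (negPf c0).
Qed.

(** Since [-(y + ih)] is the conjugate of [-y + ih], the two imaginary parts agree up to sign. Both
    signs of [expi theta'] are allowed because only vanishing matters. *)
Lemma root_Delta_reflect (R : realType) (theta theta' h : R) (p : {poly R}) y :
    expi theta' = expi (- theta) \/ expi theta' = - expi (- theta) ->
  root (Delta theta' h (p \Po - 'X)) y = root (Delta theta h p) (- y).
Proof.
move=> tE; rewrite !root_Delta /polyC_of map_comp_poly rmorphN /= map_polyX.
rewrite horner_comp !hornerE.
have -> : (- (y +i* h)%C)%R = (((- y) +i* h)%C^*)%C by [].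
rewrite -/(polyC_of p) horner_conj.
have E (z : R[i]%C) : complex.Im (expi (- theta) * (z^*)%C)
    = - complex.Im (expi theta * z).
  by rewrite -conj_expi -rmorphM /=; case: (_ * _).
by case: tE => ->; rewrite ?mulNr ?raddfN /= E ?opprK ?oppr_eq0.
Qed.

Lemma mu_min_reflect (R : realType) (p q : {poly R}) :
    (forall y, root q y = root p (- y)) ->
  mu_min p = (- mu_max q)%E.
Proof.
move=> qp; rewrite /mu_min /mu_max /ereal_inf; congr (- ereal_sup _)%E.
apply/seteqP; split => [_ [_ [x /= px <-] <-]|_ [x /= qx <-]].
  by exists (- x) => //=; rewrite qp opprK.
exists (- x)%:E; last by rewrite /= opprK.
by exists (- x) => //=; rewrite -qp.
Qed.

(** [cot phi + i] is [e^(i phi) / sin phi], so [e^(i theta) (cot phi + i)^n] is a real multiple of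
    [e^(i pi) = -1]. *)
Lemma root_Q_cot (R : realType) (theta phi : R) (n : nat) :
    0 < sin phi -> theta + phi *+ n = pi ->
  root (Q theta n) (cos phi / sin phi).
Proof.
move=> s0 tE; have sE : sin phi != 0 by rewrite gt_eqF.
rewrite root_Delta /polyC_of map_polyXn hornerXn.
have -> : (cos phi / sin phi +i* 1)%C = ((sin phi)^-1)%:C%C * expi phi.
  by rewrite complex_realM mulVf // mulrC.
rewrite exprMn mulrCA -rmorphXn.
have -> : expi phi ^+ n = expi (phi *+ n).
  elim: (n) => [|m IH]; first by rewrite expr0 expi0.
  by rewrite exprS IH mulrS expiD.
by rewrite -expiD tE complex_realM /= sinpi mulr0.
Qed.

(** * The bounds on the extreme roots *)

Lemma mu_max_Delta_le (R : realType) (n : nat) (p : {poly R}) (theta h : R) :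
    (1 <= n)%N -> size p = n.+1 -> hyperbolic p ->
    0 <= theta < pi -> 0 < h ->
  (mu_max (Delta theta h p) <= mu_max p + h%:E * mu_max (Q theta n))%E.
Proof.
move=> n0 sp hp /andP[theta0 thetapi] h0.
have n0R : 0 < n%:R :> R by rewrite ltr0n.
pose phi : R := (pi - theta) / n%:R.
have phin : theta + phi *+ n = pi.
  by rewrite -mulr_natr divfK ?gt_eqF // addrCA subrr addr0.
have phi0 : 0 < phi by rewrite divr_gt0 ?subr_gt0.
have phipi : phi <= pi.
  have n1R : 1 <= n%:R :> R by rewrite ler1n.
  by rewrite ler_pdivrMr //; have := pi_ge0 R; nra.
have [|m [-> _ mP]] := mu_maxP hp; first by rewrite sp ltnS.
apply: ge_ereal_sup => _ [y /= ry <-]; rewrite leNgt; apply/negP => ylt.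
have [s pE] := hyperbolic_split hp.
have lc0 : lead_coef p != 0 by rewrite lead_coef_eq0 hyperbolic_neq0.
have ss : size s = n.
  by apply: succn_inj; rewrite -sp pE size_scale // size_prod_XsubC.
have : 0 < complex.Im
    (expi theta * \prod_(a <- [seq y - b | b <- s]) (a +i* h)%C).
  apply: (@Im_expi_prod_gt0 R theta phi h) => //.
  - by rewrite -size_eq0 size_map ss -lt0n.
  - by rewrite phi0.
  - by rewrite size_map ss.
  move=> _ /mapP[b bs ->].
  have bm : b <= m by apply: mP; rewrite pE rootZ // root_prod_XsubC.
  (* [phi = pi] occurs only for [n = 1] and [theta = 0], where [Q] is the constant 1 and [mu_max] is
     [-oo]; the condition on [y - b] becomes [- h < 0]. *)
  have [phiE|phiN] := eqVneq phi pi; first by rewrite phiE cospi sinpi; lra.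
  have sphi : 0 < sin phi by rewrite sin_gt0_pi // phi0 lt_neqAle phiN.
  (* The chain is [b + h cot phi <= m + h mu_max (Q theta n) < y], where [cot phi] is bounded as a
     root of [Q]. *)
  rewrite -ltr_pdivrMr // ltrBrDl -lte_fin (le_lt_trans _ ylt) //.
  rewrite EFinD -mulrA EFinM leeD ?lee_fin // lee_pmul2l //.
  apply: ereal_sup_ubound; exists (cos phi / sin phi) => //.
  exact: root_Q_cot.
rewrite big_map => /lt0r_neq0/negP; apply.
move: ry; rewrite pE root_Delta_scale // root_Delta.
congr (complex.Im (_ * _) == 0).
rewrite /polyC_of rmorph_prod horner_prod; apply: eq_bigr => b _.
rewrite rmorphB /= map_polyX map_polyC !hornerE.
by apply/eqP; rewrite eq_complex /= subr0 !eqxx.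
Qed.

Theorem theorem1p7 (R : realType) (n : nat) (p : {poly R}) (theta h : R)
    (hn : (1 <= n)%N) (hdeg : size p = n.+1) (hp : hyperbolic p)
    (htheta : 0 <= theta < pi) (hh : 0 < h) :
  (mu_max (Delta theta h p) <= mu_max p + h%:E * mu_max (Q theta n))%E /\
  (mu_min (Delta theta h p) >= mu_min p + h%:E * mu_min (Q theta n))%E.
Proof.
split; first exact: mu_max_Delta_le.
(* At [theta = 0] the value [pi - theta] would leave [[0, pi[], whereas 0 is its own opposite. *)
pose theta' : R := if theta == 0 then 0 else pi - theta.
have theta'P : 0 <= theta' < pi.
  rewrite /theta'; case: eqVneq => [_|t0]; first by rewrite lexx pi_gt0.
  case/andP: htheta => t1 t2.
  by rewrite subr_ge0 ltW //= ltrBlDr ltrDl lt_neqAle eq_sym t0.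
have tE : expi theta' = expi (- theta) \/ expi theta' = - expi (- theta).
  rewrite /theta'; case: eqVneq => [->|_]; [left|right]; first by rewrite oppr0.
  rewrite addrC expiD; apply/eqP.
  by rewrite eq_complex /= cospi sinpi !mulr0 !mulrN !mulr1 subr0 add0r !eqxx.
have sX : size (- 'X : {poly R}) = 2 by rewrite size_polyN size_polyX.
have sp' : size (p \Po - 'X) = n.+1 by rewrite size_comp_poly2.
have rp' y : root (p \Po - 'X) y = root p (- y).
  by rewrite !rootE horner_comp !hornerE.
have hp' : hyperbolic (p \Po - 'X).
  move=> z; rewrite /polyC_of map_comp_poly rmorphN /= map_polyX rootE.
  rewrite horner_comp !hornerE => /hp.
  by case: z => a b /= /eqP; rewrite oppr_eq0 => /eqP.
have rQ y : root (Q theta' n) y = root (Q theta n) (- y).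
  (* Reflection turns [X^n] into [(-1)^n X^n], and the sign does not affect roots. *)
  rewrite -(root_Delta_reflect _ _ _ tE) comp_Xn_poly exprNn.
  rewrite -signr_odd mulr_sign; case: odd => //.
  by rewrite -scaleN1r root_Delta_scale ?oppr_eq0 ?oner_eq0.
rewrite (mu_min_reflect rp') (mu_min_reflect rQ).
rewrite (mu_min_reflect (fun y => root_Delta_reflect h p y tE)).
(* Taking the opposite out of the sum requires the sum to be defined: [mu_max] of the reflected [p]
   is finite, while that of [Q] can be [-oo]. *)
rewrite muleN -oppeD ?leeN2; first exact: mu_max_Delta_le.
by have [|m [-> _ _]] := mu_maxP hp'; rewrite ?sp' // fin_num_adde_defr.
Qed.
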